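(* Suppose $X$ is a smooth projective toric variety over $\mathbb{C}$ with Cox ring $S=\mathbb{C}[\alpha_1,\dots,\alpha_{n+w}]$, $L$ is a very ample line bundle on $X$, and $F\in H^0(X,L)^*$ is of minimal border rank. Let $i\in\{1,\dots,n+w\}$ be an integer such that the $X$-border rank $\mathrm{br}_X(F)$ equals $\dim H^0(X,\deg(\alpha_i))$. Then $$\dim\Big(S_L\big/\big(\mathrm{Ann}(F)_{L-\deg(\alpha_i)}\cdot S_{\deg(\alpha_i)}\big)\Big)\ \ge\ \mathrm{br}_X(F).$$
   Context: The Cox ring $S=\bigoplus_{D\in\mathrm{Pic}(X)}H^0(X,D)$ is a polynomial ring graded by $\mathrm{Pic}(X)\simeq\mathbb{Z}^w$ ($n=\dim X$) with homogeneous generators $\alpha_i$ corresponding to the torus-invariant prime divisors; $M_D$ denotes the degree $D$ piece. $X\subset\mathbb{P}(H^0(X,L)^* )$ is embedded by the complete linear system of $L$. The $X$-border rank of $F$ is the least $r$ such that $[F]$ lies in the closure of the union of linear spans of $r$-tuples of points of $X$. For $\Theta\in S_D$, $\Theta\lrcorner F\in H^0(L-D)^*$ is the functional $\Psi\mapsto F(\Theta\Psi)$; $\mathrm{Ann}(F)=\{\Theta\in S\mid\Theta\lrcorner F=0\}$, a homogeneous ideal. $F$ is concise if $\mathrm{Ann}(F)_{\deg\alpha_j}=0$ for all $j$. $F$ has minimal border rank if it is concise and $\mathrm{br}_X(F)=\max\{\dim H^0(X,\deg\alpha_j)\mid 1\le j\le n+w\}$. The product of linear subspaces $A\cdot B\subset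 S$ is the linear span of all products $ab$, $a\in A$, $b\in B$. *)

(* Defs.v *)
From HB Require Import structures.
From mathcomp Require Import all_boot all_order all_algebra.
From mathcomp Require Import boolp reals complex.
From mathcomp Require Import mpoly.

Set Implicit Arguments.
Unset Strict Implicit.
Unset Printing Implicit Defensive.

Import Order.TTheory GRing.Theory Num.Theory.
Local Open Scope ring_scope.

(* Throughout, R is the field of real numbers and R[i] the field of complex   *)
(* numbers.                                                                   *)

(* The least natural number satisfying P (0 if there is none).                *)
Definition least (P : nat -> Prop) : nat :=
  if pselect (exists d, `[< P d >]) is left exP then ex_minn exP else 0%N.

Section LinearAlgebra.
Context (K : fieldType) (V : lmodType K).

Definition lspan (T : V -> Prop) (v : V) : Prop :=
  exists k (c : 'I_k -> K) (t : 'I_k -> V),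
    (forall l, T (t l)) /\ v = \sum_l c l *: t l.

(* The images of the b l form a basis of V / W, for W a linear subspace.      *)
Definition basis_mod (W : V -> Prop) d (b : 'I_d -> V) : Prop :=
  (forall c : 'I_d -> K, W (\sum_l c l *: b l) -> forall l, c l = 0) /\
  (forall v : V, exists c : 'I_d -> K, W (v - \sum_l c l *: b l)).

Definition dim_quot (W : V -> Prop) : nat :=
  least (fun d => exists b : 'I_d -> V, basis_mod W b).

Definition dim_space : nat := dim_quot (fun v => v = 0).

(* Membership of [F] in the Zariski closure of the set of classes [G], for   *)
(* G in the set A of functionals (A being stable under scaling), in the       *)
(* projective space of the dual of V. A homogeneous polynomial on the dual is *)
(* a homogeneous polynomial expression in evaluations at finitely many        *)
(* vectors of V.                                                              *)
Definition zariski_closure (A : (V -> K) -> Prop) (F : V -> K) : Prop :=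
  forall k (s : 'I_k -> V) d (p : {mpoly K[k]}), p \is d.-homog ->
    (forall G, A G -> p.@[fun l => G (s l)] = 0) ->
    p.@[fun l => F (s l)] = 0.

End LinearAlgebra.

(* Product A . B of linear subspaces of a polynomial ring, and k-th powers.   *)
Definition prod_space (K : fieldType) N (A B : {mpoly K[N]} -> Prop) :=
  lspan (fun f : {mpoly K[N]} => exists a b, [/\ A a, B b & f = a * b]).

Fixpoint pow_space (K : fieldType) N (A : {mpoly K[N]} -> Prop) k :=
  if k is k'.+1 then prod_space A (pow_space A k')
  else lspan (fun f : {mpoly K[N]} => f = 1).

(* A simplicial fan in Z^n with n + w rays: row j of rays is the primitive    *)
(* generator u_j of the j-th ray, and a cone is recorded as the set of        *)
(* indices of its rays.                                                       *)
Record fan n w := Fan {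
  rays : 'M[int]_(n + w, n);
  cones : {set {set 'I_(n + w)}} }.

Section Toric.
Context (R : realType) (n w : nat) (X : fan n w).
Local Notation N := (n + w)%N.
Local Notation C := R[i].
Local Notation S := {mpoly C[N]}.

Definition in_cone (s : {set 'I_N}) (v : 'rV[R]_n) : Prop :=
  exists c : 'I_N -> R, (forall j, 0 <= c j) /\
    v = \sum_(j in s) c j *: map_mx intr (row j (rays X)).

Definition is_fan : Prop :=
  [/\ set0 \in cones X,
      forall j, [set j] \in cones X,
      forall s t : {set 'I_N}, t \in cones X -> s \subset t -> s \in cones X
    & forall s t : {set 'I_N}, s \in cones X -> t \in cones X ->
        forall v, in_cone s v -> in_cone t v -> in_cone (s :&: t) v].

(* The generators of each cone are part of a Z-basis of Z^n.                  *)
Definition smooth_fan : Prop :=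
  forall s : {set 'I_N}, s \in cones X ->
    exists (B : 'M[int]_n) (f : 'I_N -> 'I_n),
      [/\ B \in unitmx, {in s &, injective f}
        & forall j, j \in s -> row (f j) B = row j (rays X)].

Definition complete_fan : Prop :=
  forall v, exists2 s, s \in cones X & in_cone s v.

(* Torus-invariant divisors are the integer vectors (a_1, ..., a_N), standing *)
(* for \sum_j a_j D_j. On a smooth toric variety every line bundle is O(D)    *)
(* for such a D, unique up to linear equivalence: Pic(X) = Z^N / div(Z^n).    *)
Definition divisor := 'rV[int]_N.

(* The divisor (<m, u_j>)_j of the character m.                               *)
Definition div_char (m : 'rV[int]_n) : divisor := m *m (rays X)^T.

Definition lin_equiv (D E : divisor) : Prop :=
  exists m, D - E = div_char m.

(* The degree of alpha_j.                                                     *)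
Definition deg_var (j : 'I_N) : divisor := delta_mx 0 j.

Definition deg_mnm (e : 'X_{1.. N}) : divisor := \row_j (e j)%:Z.

(* f is in the degree [D] piece of the Cox ring.                              *)
Definition cox_degree (D : divisor) : {pred S} :=
  fun f => all (fun e => `[< lin_equiv (deg_mnm e) D >]) (msupp f).

Lemma cox_degreeP D f :
  reflect (forall e, e \in msupp f -> lin_equiv (deg_mnm e) D)
          (f \in cox_degree D).
Proof. by apply: (iffP allP) => h e /h /asboolP. Qed.

Fact cox_degree_submod_closed D : submod_closed (cox_degree D).
Proof.
split=> [|c p q]; first by apply/cox_degreeP => e; rewrite msupp0.
move=> /cox_degreeP hp /cox_degreeP hq; apply/cox_degreeP => e /msuppD_le.
by rewrite mem_cat => /orP[/msuppZ_le /hp|/hq].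
Qed.

HB.instance Definition _ D :=
  GRing.isSubmodClosed.Build C S (cox_degree D) (cox_degree_submod_closed D).

(* H^0(X, O(D)), as the degree [D] piece S_D of the Cox ring.                 *)
Record H0 (D : divisor) := MkH0 { H0val :> S; H0valP : H0val \in cox_degree D }.

HB.instance Definition _ D := [isSub for @H0val D].
HB.instance Definition _ D := [Choice of H0 D by <:].
HB.instance Definition _ D := [SubChoice_isSubLmodule of H0 D by <:].

Lemma cox_degreeM D E f g :
  f \in cox_degree D -> g \in cox_degree E -> f * g \in cox_degree (D + E).
Proof.
move=> /cox_degreeP hf /cox_degreeP hg; apply/cox_degreeP => e.
move=> /msuppM_le /allpairsP[[a b] /= [/hf[m hm] /hg[m' hm'] ->]].
exists (m + m'); rewrite /div_char mulmxDl -![_ *m _]/(div_char _) -hm -hm'.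
by apply/rowP => j; rewrite !mxE mnmDE PoszD opprD addrACA.
Qed.

Fact cox_mul_subproof D L (f : H0 D) (g : H0 (L - D)) :
  (f : S) * (g : S) \in cox_degree L.
Proof.
by have := cox_degreeM (H0valP f) (H0valP g); rewrite addrCA subrr addr0.
Qed.

Definition cox_mul D L (f : H0 D) (g : H0 (L - D)) : H0 L :=
  MkH0 (cox_mul_subproof f g).

(* X as the geometric quotient (C^N \ Z) / G: the point with Cox coordinates  *)
(* x is defined if the vanishing coordinates index a cone, and                *)
(* G = Hom(Pic(X), C^* ) is the group of t in (C^* )^N with                   *)
(* \prod_j t_j ^ <m, u_j> = 1 for all m in Z^n.                               *)
Definition is_point (x : 'I_N -> C) : Prop := [set j | x j == 0] \in cones X.

Definition same_point (x y : 'I_N -> C) : Prop :=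
  exists t : 'I_N -> C,
    [/\ forall j, t j != 0,
        forall m, \prod_j t j ^ (div_char m 0 j) = 1
      & forall j, y j = t j * x j].

(* A representative of the image of the point x in P(H^0(X, D)^* ).           *)
Definition ev D (x : 'I_N -> C) (f : H0 D) : C := (f : S).@[x].

(* |D| is base point free, and X -> P(H^0(X, D)^* ) is a closed immersion:    *)
(* injective, closed, and surjective on local rings. Closed subsets of X are  *)
(* the zero loci of sets of homogeneous elements of S; the local ring of X at *)
(* x consists of the fractions g / h of homogeneous elements of S of the same *)
(* degree with h(x) <> 0, and that of the projective space at the image of x  *)
(* gives those with g and h polynomials of the same degree k in the sections  *)
(* of O(D).                                                                   *)
Definition very_ample (D : divisor) : Prop :=
  [/\ forall x, is_point x -> exists f : H0 D, ev x f != 0,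
      forall x y, is_point x -> is_point y ->
        (exists c, forall f : H0 D, ev x f = c * ev y f) -> same_point x y,
      forall T : S -> Prop,
        (forall f, T f -> exists E, f \in cox_degree E) ->
        let image (G : H0 D -> C) := exists (x : 'I_N -> C) (c : C),
          [/\ is_point x, forall f, T f -> f.@[x] = 0
            & forall f, G f = c * ev x f] in
        forall G, zariski_closure image G -> image G
    & forall x, is_point x ->
        forall E (g h : H0 E), ev x h != 0 ->
        exists k (p q : S),
          [/\ pow_space (fun f => f \in cox_degree D) k p,
              pow_space (fun f => f \in cox_degree D) k q,
              q.@[x] != 0 & (g : S) * q = (h : S) * p]].

Definition smooth_projective_toric : Prop :=
  [/\ is_fan, smooth_fan, complete_fan & exists D, very_ample D].

Section Apolarity.
Context (L : divisor) (F : {scalar H0 L}).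

(* F lies in the affine cone over the union of the linear spans of r-tuples   *)
(* of points of X.                                                            *)
Definition in_span_of_points r (G : H0 L -> C) : Prop :=
  exists (x : 'I_r -> 'I_N -> C) (c : 'I_r -> C),
    (forall l, is_point (x l)) /\ forall f, G f = \sum_l c l * ev (x l) f.

Definition border_rank : nat :=
  least (fun r => zariski_closure (in_span_of_points r) F).

Definition contract D (theta : H0 D) : H0 (L - D) -> C :=
  fun psi => F (cox_mul theta psi).

(* Ann(F)_D, as a subspace of S.                                              *)
Definition ann D (f : S) : Prop :=
  exists2 theta : H0 D, f = theta & forall psi, contract theta psi = 0.

Definition concise : Prop :=
  forall j f, ann (deg_var j) f -> f = 0.

Definition minimal_border_rank : Prop :=
  concise /\ border_rank = \max_(j < N) dim_space (H0 (deg_var j)).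

End Apolarity.

End Toric.

Arguments H0 R {n w} X D.
Arguments cox_degree R {n w} X D.
Arguments smooth_projective_toric R {n w} X.
Arguments very_ample R {n w} X D.

(* Main.v *)
From HB Require Import structures.
Require Import Defs.
From mathcomp Require Import all_boot all_order all_algebra.
From mathcomp Require Import boolp reals complex mpoly.

Set Implicit Arguments.
Unset Strict Implicit.
Unset Printing Implicit Defensive.

Import Order.TTheory GRing.Theory Num.Theory.
Local Open Scope ring_scope.

(** Write D for the degree of alpha_i and r for the border rank of F, so that
    r = dim S_D, and let W be the product Ann(F)_(L-D) . S_D inside S_L. The
    claim is that W has codimension at least r in S_L.

    Suppose first that F itself is a combination of evaluations at r points
    x_1, ..., x_r. By conciseness the pairing S_D x S_(L-D) -> C induced by F
    has rank r, the largest possible. Since evaluation at a point is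
    multiplicative, this pairing is a sum of r rank-one pairings, one for each
    point; so these are independent, and an element of S_(L-D) lies in Ann(F)
    exactly when it vanishes at every x_l. Hence W vanishes at every x_l
    ([products_kill]), while the r evaluations are linearly independent on S_L
    ([products_free]): W has codimension at least r.

    The general F is only a limit of such functionals, and the argument is
    carried to the limit by a determinant rather than by a limit of ideals.
    Choose a_1, ..., a_r in S_D and b_1, ..., b_r in S_(L-D) whose Gram
    determinant Delta(F) = det (F(a_j b_l)) is nonzero ([exists_det_neq0]). By
    Cramer's rule, any u in S_(L-D) can be corrected, for every functional G on
    S_L, to an element [kernel_part G u] whose products with the a_j are sent to
    0 by G, whose products with sections have coordinates that are forms of
    degree r in G, and which is Delta(F) u when G = F and u is in Ann(F). If W
    had codimension d < r, each monomial of degree L would be a combination of d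
    fixed elements g_1, ..., g_d and of products of elements of Ann(F)_(L-D)
    with elements of S_D. Replacing each factor in Ann(F) by its corrected
    version and scaling the g_l by Delta(G) produces a square matrix P(G), whose
    entries are forms in G, with P(F) = Delta(F) times the identity. When G is a
    combination of r evaluations with Delta(G) <> 0, some nonzero combination of
    these evaluations kills the d elements g_l; it also kills the corrected
    products, so det P(G) = 0. The form Delta . det P thus vanishes on all
    combinations of r evaluations, hence on their Zariski closure, although its
    value at F is a power of Delta(F) ([codim_kernel_products]).

    This uses a finite basis of S_L, which comes from completeness of the fan
    ([effective_coord_bounded]). *)

(** * Functions given by homogeneous polynomials *)

(** A property of functions and not of polynomials, so that determinants and
    adjugates are those of matrices over K, to which linear algebra applies. *)
Definition form_fun (K : fieldType) N d (phi : ('I_N -> K) -> K) : Prop :=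
  exists p : {mpoly K[N]}, p \is d.-homog /\ forall z, phi z = p.@[z].

Section FormFun.
Context (K : fieldType) (N : nat).
Implicit Types (phi psi : ('I_N -> K) -> K).

Lemma eq_form_fun d phi psi :
  psi =1 phi -> form_fun d phi -> form_fun d psi.
Proof. by move=> /funext ->. Qed.

Lemma form_fun_lin (k : 'I_N -> K) : form_fun 1 (fun z => \sum_m k m * z m).
Proof.
exists (\sum_m k m *: 'X_m); split=> [|z].
  by apply: rpred_sum => m _; rewrite rpredZ // dhomogX /= mdeg1.
by rewrite raddf_sum; apply: eq_bigr => m _ /=; rewrite mevalZ mevalXU.
Qed.

Lemma form_funD d phi psi :
  form_fun d phi -> form_fun d psi -> form_fun d (fun z => phi z + psi z).
Proof.
move=> [p [hp hphi]] [q [hq hpsi]]; exists (p + q).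
by split=> [|z]; [exact: rpredD | rewrite mevalD hphi hpsi].
Qed.

Lemma form_funZ d c phi : form_fun d phi -> form_fun d (fun z => c * phi z).
Proof.
move=> [p [hp hphi]]; exists (c *: p).
by split=> [|z]; [exact: rpredZ | rewrite mevalZ hphi].
Qed.

Lemma form_funM d e phi psi :
  form_fun d phi -> form_fun e psi -> form_fun (d + e) (fun z => phi z * psi z).
Proof.
move=> [p [hp hphi]] [q [hq hpsi]]; exists (p * q).
by split=> [|z]; [exact: dhomogM | rewrite mevalM hphi hpsi].
Qed.

Lemma form_fun_sum (I : finType) d (phi : I -> ('I_N -> K) -> K) :
  (forall i, form_fun d (phi i)) -> form_fun d (fun z => \sum_i phi i z).
Proof.
move=> /choice[p hp]; exists (\sum_i p i); split=> [|z].
  by apply: rpred_sum => i _; case: (hp i).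
by rewrite raddf_sum; apply: eq_bigr => i _; case: (hp i).
Qed.

Lemma form_fun_prod n d (phi : 'I_n -> ('I_N -> K) -> K) :
  (forall i, form_fun d (phi i)) -> form_fun (n * d) (fun z => \prod_i phi i z).
Proof.
move=> /choice[p hp]; exists (\prod_i p i); split=> [|z]; last first.
  by rewrite rmorph_prod; apply: eq_bigr => i _; case: (hp i).
rewrite -[n in (n * d)%N]card_ord -sum_nat_const.
apply: (big_ind2 (fun (q : {mpoly K[N]}) e => q \is e.-homog)).
- exact: dhomog1.
- by move=> q e q' e' hq hq'; exact: dhomogM.
- by move=> i _; case: (hp i).
Qed.

Lemma form_fun_det n d (M : ('I_N -> K) -> 'M[K]_n) :
  (forall i j, form_fun d (fun z => M z i j)) ->
  form_fun (n * d) (fun z => \det (M z)).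
Proof.
by move=> hM; apply: form_fun_sum => s; apply/form_funZ/form_fun_prod.
Qed.

Lemma form_fun_adj n d (M : ('I_N -> K) -> 'M[K]_n) :
  (forall i j, form_fun d (fun z => M z i j)) ->
  forall i j, form_fun (n.-1 * d) (fun z => (\adj (M z)) i j).
Proof.
move=> hM i j.
apply: (@eq_form_fun _ (fun z => cofactor (M z) j i)) => [z|].
  by rewrite mxE.
apply/form_funZ/form_fun_det => k l.
by apply: eq_form_fun (hM (lift j k) (lift i l)) => z; rewrite !mxE.
Qed.

End FormFun.

(** * Linear algebra *)

(** Points are chosen one at a time: while there are fewer than r of them, some
    nonzero combination of the f j vanishes at all of them, and any point where
    this combination does not vanish can be added, keeping independent the
    vectors of values of the f j. *)
Lemma exists_det_neq0 (K : fieldType) (T : Type) r (f : 'I_r -> T -> K) :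
  (forall c : 'I_r -> K,
     (forall t, \sum_j c j * f j t = 0) -> forall j, c j = 0) ->
  exists t : 'I_r -> T, \det (\matrix_(j, l) f j (t l)) != 0.
Proof.
move=> f_free.
have free_rows k : (k <= r)%N ->
    exists t : 'I_k -> T, row_free (\matrix_(l < k, j < r) f j (t l)).
  elim: k => [|k IHk] ltkr.
    exists (fun l : 'I_0 => False_rect T (notF (ltn_ord l))).
    by rewrite -row_leq_rank.
  have [t t_free] := IHk (ltnW ltkr); set M := \matrix_(l, j) _ in t_free.
  have /rowV0Pn[u /sub_kermxP uM u0]: kermx M^T != 0.
    by rewrite -mxrank_eq0 mxrank_ker mxrank_tr (eqP t_free) subn_eq0 -ltnNge.
  have [s us]: exists s, \sum_j u 0 j * f j s != 0.
    apply: contrapT => h; move/eqP: u0; apply; apply/rowP => j; rewrite mxE.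
    apply: (f_free (fun j => u 0 j)) => s.
    by apply/eqP; apply: contrapT => /negP us; apply: h; exists s.
  pose t' (l : 'I_(k + 1)) := if split l is inl l' then t l' else s.
  rewrite -addn1; exists t'.
  pose v : 'rV_r := \row_j f j s.
  have -> : \matrix_(l < k + 1, j < r) f j (t' l) = col_mx M v.
    by apply/matrixP => l j; rewrite !mxE /t'; case: split => l'; rewrite !mxE.
  apply: inj_row_free => y; rewrite -(hsubmxK y) mul_row_col => y0.
  have y20: rsubmx y = 0.
    have := congr1 (mulmx^~ u^T) y0.
    rewrite mul0mx mulmxDl -!mulmxA -[M]trmxK -trmx_mul uM trmx0 mulmx0 add0r.
    rewrite [v *m _]mx11_scalar mul_mx_scalar => /eqP; rewrite scaler_eq0.
    case/orP=> /eqP // e; case/eqP: us; rewrite -[RHS]e !mxE.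
    by apply: eq_bigr => j _; rewrite !mxE mulrC.
  move: y0; rewrite y20 mul0mx addr0 => y10.
  suff -> : lsubmx y = 0 by rewrite row_mx0.
  by apply: (row_free_inj t_free); rewrite y10 mul0mx.
have [t] := free_rows r (leqnn r).
rewrite row_free_unit unitmxE unitfE => t_free.
exists t; rewrite -det_tr; congr (\det _ != 0): t_free.
by apply/matrixP => j l; rewrite !mxE.
Qed.

(** * Kernels of pairings induced by limits of sums of products *)

Section Products.
Context (K : fieldType) (A : Type) (U V : lmodType K).
Context (mu : A -> {linear U -> V}).

(** The pairing (x, u) |-> e (mu x u) has rank at most one, as for evaluation at
    a point when mu is multiplication of functions. *)
Definition product_functional (e : V -> K) : Prop :=
  exists (al : A -> K) (be : U -> K), forall x u, e (mu x u) = al x * be u.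

Definition sum_of_products r (G : V -> K) : Prop :=
  exists (e : 'I_r -> {scalar V}) (c : 'I_r -> K),
    (forall l, product_functional (e l)) /\ forall v, G v = \sum_l c l * e l v.

Definition gram r (a : 'I_r -> A) (b : 'I_r -> U) (G : V -> K) : 'M[K]_r :=
  \matrix_(j, l) G (mu (a j) (b l)).

Definition kernel_products (G : V -> K) (v : V) : Prop :=
  exists x u, (forall x', G (mu x' u) = 0) /\ v = mu x u.

Lemma scalar_sum r (y : 'I_r -> K) (e : 'I_r -> {scalar V}) :
  exists E : {scalar V}, forall w, E w = \sum_l y l * e l w.
Proof.
pose E w := \sum_l y l * e l w.
have E_lin : scalar E.
  move=> t w w'; rewrite /E mulr_sumr -big_split; apply: eq_bigr => l _ /=.
  by rewrite linearP mulrDr mulrCA.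
pose E_mixin := GRing.isLinear.Build K V K _ E E_lin.
by exists (HB.pack_for {scalar V} E E_mixin).
Qed.

Context (r : nat) (a : 'I_r -> A) (b : 'I_r -> U).

Lemma product_functional_factors (e : 'I_r -> V -> K) :
  (forall l, product_functional (e l)) ->
  exists (al : 'I_r -> A -> K) (be : 'I_r -> U -> K),
    forall l x u, e l (mu x u) = al l x * be l u.
Proof. by move=> /choice[al] /choice[be h]; exists al, be. Qed.

Lemma gram_products (G : V -> K) (e : 'I_r -> V -> K) c al be :
  (forall l x u, e l (mu x u) = al l x * be l u) ->
  (forall v, G v = \sum_l c l * e l v) ->
  gram a b G =
    (\matrix_(j, l) (c l * al l (a j))) *m (\matrix_(l, k) be l (b k)).
Proof.
move=> he hG; apply/matrixP => j k; rewrite !mxE hG.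
by apply: eq_bigr => l _; rewrite !mxE he mulrA.
Qed.

(** The r rank-one pairings sum to a pairing of rank r, so their left factors
    are independent, and the right kernel of the sum is the common zero locus of
    the right factors. *)
Lemma products_kill (G : V -> K) (e : 'I_r -> V -> K) c :
  (forall l, product_functional (e l)) ->
  (forall v, G v = \sum_l c l * e l v) ->
  \det (gram a b G) != 0 ->
  forall u, (forall j, G (mu (a j) u) = 0) -> forall l x, e l (mu x u) = 0.
Proof.
move=> he hG; have [al [be hp]] := product_functional_factors he.
rewrite (gram_products hp hG) det_mulmx mulf_eq0 negb_or.
move=> /andP[Pdet _] u hu l x.
pose P := \matrix_(j, l) (c l * al l (a j)).
have Pu : P *m (\col_l be l u) = 0.
  apply/matrixP => j k; rewrite !mxE -[RHS](hu j) hG.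
  by apply: eq_bigr => m _; rewrite !mxE hp mulrA.
have /matrixP/(_ l 0) : \col_l be l u = 0.
  have Pun : P \in unitmx by rewrite unitmxE unitfE.
  by rewrite -[LHS](mulKmx Pun) Pu mulmx0.
by rewrite !mxE hp => ->; rewrite mulr0.
Qed.

(** A relation between the e l makes the product of the two invertible matrices
    of left and right factors vanish after inserting the diagonal matrix of its
    coefficients. *)
Lemma products_free (G : V -> K) (e : 'I_r -> V -> K) c :
  (forall l, product_functional (e l)) ->
  (forall v, G v = \sum_l c l * e l v) ->
  \det (gram a b G) != 0 ->
  forall y : 'rV_r, (forall v, \sum_l y 0 l * e l v = 0) -> y = 0.
Proof.
move=> he hG; have [al [be hp]] := product_functional_factors he.
rewrite (gram_products hp hG) det_mulmx mulf_eq0 negb_or.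
move=> /andP[Pdet Qdet] y hy.
set Q := \matrix_(l, k) _ in Qdet; set P := \matrix_(j, l) _ in Pdet.
have Qun : Q \in unitmx by rewrite unitmxE unitfE.
have yal j : \row_l (y 0 l * al l (a j)) = 0.
  rewrite -[LHS](mulmxK Qun) (_ : _ *m Q = 0) ?mul0mx //.
  apply/matrixP => i k; rewrite !mxE -[RHS](hy (mu (a j) (b k))).
  by apply: eq_bigr => l _; rewrite !mxE hp mulrA.
apply/rowP => l; rewrite mxE; apply/eqP; apply: contraNT Pdet => yl.
rewrite (expand_det_col _ l) big1 // => j _.
have /rowP/(_ l) := yal j; rewrite !mxE => /eqP.
by rewrite mulf_eq0 (negPf yl) => /eqP ->; rewrite mulr0 mul0r.
Qed.

(** Cramer's correction of u by the b l, scaled by the Gram determinant to clear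
    denominators: it is defined for every G, and polynomial in G. *)
Definition kernel_part (G : V -> K) (u : U) : U :=
  \det (gram a b G) *: u
  - \sum_l (\adj (gram a b G) *m \col_j G (mu (a j) u)) l 0 *: b l.

Lemma kernel_part_killed (G : {scalar V}) u j :
  G (mu (a j) (kernel_part G u)) = 0.
Proof.
set M := gram a b G; set cc := \col_j G (mu (a j) u).
have /matrixP/(_ j 0) : M *m (\adj M *m cc) = \det M *: cc.
  by rewrite mulmxA mul_mx_adj mul_scalar_mx.
rewrite !mxE => H; rewrite /kernel_part !linearB !linearZ -/M /=.
rewrite -H !linear_sum; apply/eqP; rewrite subr_eq0; apply/eqP.
by apply: eq_bigr => l _; rewrite !linearZ /= !mxE mulrC.
Qed.

Lemma kernel_part_id (G : V -> K) u :
  (forall x, G (mu x u) = 0) -> kernel_part G u = \det (gram a b G) *: u.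
Proof.
move=> hu; rewrite /kernel_part (_ : \col_j _ = 0); last first.
  by apply/matrixP => j k; rewrite !mxE hu.
by rewrite mulmx0 big1 ?subr0 // => l _; rewrite mxE scale0r.
Qed.

Context (N : nat) (v : 'I_N -> V) (kap : 'I_N -> {scalar V}).
Hypothesis vK : forall w, w = \sum_m kap m w *: v m.
Hypothesis kapv : forall m k, kap m (v k) = (m == k)%:R.

(** The functional with coordinates z in the basis dual to v. *)
Definition dual_vector (z : 'I_N -> K) : V -> K :=
  fun w => \sum_m kap m w * z m.

Lemma dual_vector_is_scalar z : scalar (dual_vector z).
Proof.
move=> t w w'; rewrite /dual_vector mulr_sumr -big_split.
apply: eq_bigr => m _ /=.
by rewrite linearP mulrDl mulrA.
Qed.

HB.instance Definition _ z :=
  GRing.isLinear.Build K V K _ (dual_vector z) (dual_vector_is_scalar z).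

Lemma dual_vectorK (G : {scalar V}) : dual_vector (fun m => G (v m)) =1 G.
Proof.
move=> w; rewrite [in RHS](vK w) linear_sum; apply: eq_bigr => m _.
by rewrite linearZ.
Qed.

Lemma form_fun_gram i j : form_fun 1 (fun z => gram a b (dual_vector z) i j).
Proof.
apply: eq_form_fun (form_fun_lin (fun m => kap m (mu (a i) (b j)))) => z.
by rewrite mxE.
Qed.

Lemma form_fun_det_gram : form_fun r (fun z => \det (gram a b (dual_vector z))).
Proof.
by rewrite -[r in form_fun r]muln1; apply/form_fun_det/form_fun_gram.
Qed.

Lemma form_fun_kernel_part m x u : (0 < r)%N ->
  form_fun r (fun z => kap m (mu x (kernel_part (dual_vector z) u))).
Proof.
move=> r_gt0.
apply: (@eq_form_fun _ _ _ (fun z =>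
    kap m (mu x u) * \det (gram a b (dual_vector z))
    + \sum_l - kap m (mu x (b l)) * \sum_j (\adj (gram a b (dual_vector z))) l j
        * dual_vector z (mu (a j) u))) => [z|].
  rewrite /kernel_part !linearB !linearZ /= mulrC !linear_sum -sumrN.
  congr (_ + _); apply: eq_bigr => l _; rewrite !linearZ /= mulNr mulrC !mxE.
  by congr (- (_ * _)); apply: eq_bigr => j _; rewrite !mxE.
apply: form_funD; first by apply/form_funZ/form_fun_det_gram.
apply: form_fun_sum => l; apply: form_funZ; apply: form_fun_sum => j.
rewrite -[r in form_fun r](prednK r_gt0) -addn1 -[r.-1]muln1.
apply: form_funM; first exact/form_fun_adj/form_fun_gram.
exact: form_fun_lin.
Qed.

(** An element w of the span of the products with Ker F moves polynomially with
    the functional z, staying in the span of the products with elements killed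
    by z; at F it is w scaled by the Gram determinant. *)
Lemma deform_kernel_span (F : {scalar V}) w : (0 < r)%N ->
  lspan (kernel_products F) w ->
  exists om : ('I_N -> K) -> V,
    [/\ forall m, form_fun r (fun z => kap m (om z)),
        om (fun m => F (v m)) = \det (gram a b F) *: w
      & forall z (e : {scalar V}),
          (forall x u, (forall j, dual_vector z (mu (a j) u) = 0) ->
             e (mu x u) = 0) -> e (om z) = 0].
Proof.
move=> r_gt0 [n [c [t [ht ->]]]].
have [x /choice[u hu]] := choice ht.
exists (fun z => \sum_l c l *: mu (x l) (kernel_part (dual_vector z) (u l))).
split=> [m||z e he].
- apply: (@eq_form_fun _ _ _ (fun z =>
      \sum_l c l * kap m (mu (x l) (kernel_part (dual_vector z) (u l)))))
    => [z|].
    by rewrite linear_sum; apply: eq_bigr => l _; rewrite linearZ.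
  by apply: form_fun_sum => l; apply/form_funZ/form_fun_kernel_part.
- have /funext -> := dual_vectorK F; rewrite scaler_sumr; apply: eq_bigr => l _.
  have [ker_u ->] := hu l.
  by rewrite kernel_part_id // linearZ scalerA mulrC -scalerA.
- rewrite linear_sum big1 // => l _; rewrite linearZ /= he ?mulr0 // => j.
  exact: kernel_part_killed.
Qed.

(** The codimension bound, in the form: the span of the products with Ker F
    together with fewer than r vectors is never the whole space. *)
Theorem codim_kernel_products (F : {scalar V}) :
  \det (gram a b F) != 0 ->
  zariski_closure (sum_of_products r) F ->
  forall d (g : 'I_d -> V),
    (forall w, exists c : 'I_d -> K,
       lspan (kernel_products F) (w - \sum_l c l *: g l)) ->
    (r <= d)%N.
Proof.
move=> detF clF d g hg; rewrite leqNgt; apply/negP => ltdr.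
have r_gt0 : (0 < r)%N by apply: leq_ltn_trans ltdr.
have [c hc] := choice (fun m => hg (v m)).
have [om hom] := choice (fun m => deform_kernel_span r_gt0 (hc m)).
pose Delta z := \det (gram a b (dual_vector z)).
(* vz z k is the deformation of the basis vector v k, up to a scalar. *)
pose vz z k := Delta z *: (\sum_l c k l *: g l) + om k z.
pose P z : 'M[K]_N := \matrix_(k, m) kap m (vz z k).
have hP k m : form_fun r (fun z => P z k m).
  apply: (@eq_form_fun _ _ _ (fun z =>
      kap m (\sum_l c k l *: g l) * Delta z + kap m (om k z))) => [z|].
    by rewrite mxE linearD linearZ /= mulrC.
  apply: form_funD; first by apply/form_funZ/form_fun_det_gram.
  by case: (hom k) => + _ _; apply.
have [p [p_hom hp]] := form_funM (form_fun_det hP) form_fun_det_gram.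
(* The factor Delta disposes of the functionals whose pairing is degenerate. *)
have P_sing G : sum_of_products r G -> p.@[fun m => G (v m)] = 0.
  move=> [e [c' [he hG]]]; rewrite -hp; set z := fun m => G (v m).
  have GK : dual_vector z = G.
    apply/funext => w; rewrite hG [in RHS](vK w) /dual_vector.
    under [RHS]eq_bigr do rewrite linear_sum mulr_sumr.
    rewrite exchange_big; apply: eq_bigr => m _ /=.
    rewrite /z hG mulr_sumr; apply: eq_bigr => l _.
    by rewrite linearZ mulrCA.
  have [->|detG] := eqVneq (\det (gram a b (dual_vector z))) 0.
    by rewrite mulr0.
  rewrite GK in detG.
  have /rowV0Pn[y /sub_kermxP yg y0] :
      kermx (\matrix_(l < r, k < d) e l (g k)) != 0.
    rewrite -mxrank_eq0 mxrank_ker subn_eq0 -ltnNge.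
    exact: leq_ltn_trans (rank_leq_col _) ltdr.
  (* E kills all the vectors vz z k, so its values on the basis v lie in the
     kernel of P z. *)
  have [E hE] := scalar_sum (y 0) e.
  have Eg l : E (g l) = 0.
    have /matrixP/(_ 0 l) := yg; rewrite !mxE hE => yg0; rewrite -[RHS]yg0.
    by apply: eq_bigr => k _; rewrite !mxE.
  have Evz k : E (vz z k) = 0.
    rewrite linearD linearZ linear_sum /= big1 => [|l _]; last first.
      by rewrite linearZ /= Eg mulr0.
    rewrite mulr0 add0r; have [_ _ ->//] := hom k => x u hu.
    rewrite GK in hu; rewrite hE big1 // => l _.
    by rewrite (products_kill he hG detG hu) mulr0.
  apply/eqP; rewrite mulf_eq0; apply/orP; left; apply: contraNT y0 => detP.
  have Pun : P z \in unitmx by rewrite unitmxE unitfE.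
  have Ev0 : \col_m E (v m) = 0.
    rewrite -[LHS](mulKmx Pun) (_ : P z *m _ = 0) ?mulmx0 //.
    apply/matrixP => k j; rewrite !mxE -[RHS](Evz k) [in RHS](vK (vz z k)).
    by rewrite linear_sum; apply: eq_bigr => m _; rewrite linearZ /= !mxE.
  apply/eqP/(products_free he hG detG) => w.
  rewrite -hE [w]vK linear_sum big1 // => m _; rewrite linearZ /=.
  by have /matrixP/(_ m 0) := Ev0; rewrite !mxE => ->; rewrite mulr0.
have /funext FK := dual_vectorK F.
have := clF _ v _ p p_hom P_sing; rewrite -hp FK.
suff -> : P (fun m => F (v m)) = (\det (gram a b F))%:M.
  by move/eqP; rewrite det_scalar mulf_eq0 expf_eq0 (negPf detF) andbF.
apply/matrixP => k m; rewrite !mxE /vz /Delta FK.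
have [_ -> _] := hom k.
by rewrite -scalerDr addrC subrK linearZ /= kapv eq_sym mulr_natr.
Qed.
End Products.

(** * Dimensions of quotients *)

Lemma leastP (P : nat -> Prop) : (0 < least P)%N -> P (least P).
Proof.
by rewrite /least; case: pselect => // exP; case: ex_minnP => m /asboolP.
Qed.

Section Quotients.
Context (K : fieldType) (V : lmodType K) (W : V -> Prop).
Hypothesis W_lin : forall c u v, W u -> W v -> W (c *: u + v).

Definition spans_mod d (g : 'I_d -> V) : Prop :=
  forall v, exists c : 'I_d -> K, W (v - \sum_l c l *: g l).

Lemma spans_mod_shrink d (g : 'I_d.+1 -> V) c l :
  spans_mod g -> W (\sum_k c k *: g k) -> c l != 0 ->
  spans_mod (g \o lift l).
Proof.
move=> hg Wc cl v; have [c' Wc'] := hg v.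
exists (fun k => c' (lift l k) - c' l / c l * c (lift l k)).
have := W_lin (c' l / c l) Wc Wc'; congr W.
rewrite scaler_sumr addrCA; congr (_ + _).
rewrite (bigD1_ord l) //= [X in _ - X](bigD1_ord l) //= scalerA divfK //.
rewrite opprD addrACA subrr add0r -!sumrN -big_split; apply: eq_bigr => k _ /=.
by rewrite scalerBl opprB scalerA.
Qed.

(** A spanning family of least length is a basis. *)
Lemma exists_basis_mod d (g : 'I_d -> V) :
  spans_mod g -> exists d' (b : 'I_d' -> V), basis_mod W b.
Proof.
move=> hg; have exP : exists d, `[< exists g : 'I_d -> V, spans_mod g >].
  by exists d; apply/asboolP; exists g.
case: (ex_minnP exP) => -[|m] /asboolP[b hb] minm; exists _, b; split=> //.
  by move=> c _ [].
move=> c Wc l; apply/eqP; apply: contraT => cl.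
suff /minm : `[< exists g : 'I_m -> V, spans_mod g >] by rewrite ltnn.
by apply/asboolP; exists (b \o lift l); exact: spans_mod_shrink Wc cl.
Qed.

(** The finite spanning family g excludes the default value 0 that [dim_quot]
    takes on a quotient of infinite dimension. *)
Lemma dim_quot_ge r d (g : 'I_d -> V) : spans_mod g ->
  (forall d (b : 'I_d -> V), spans_mod b -> (r <= d)%N) -> (r <= dim_quot W)%N.
Proof.
move=> /exists_basis_mod[d' [b hb]] ge_r; rewrite /dim_quot /least.
case: pselect => [exP|[]]; last by exists d'; apply/asboolP; exists b.
by case: ex_minnP => m /asboolP[b' [_ hb']] _; exact: ge_r hb'.
Qed.

End Quotients.

Lemma lspan_lin (K : fieldType) (V : lmodType K) (T : V -> Prop) c u v :
  lspan T u -> lspan T v -> lspan T (c *: u + v).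
Proof.
move=> [k [a [t [ht ->]]]] [k' [a' [t' [ht' ->]]]].
exists (k + k')%N,
  (fun l => match split l with inl i => c * a i | inr i => a' i end),
  (fun l => match split l with inl i => t i | inr i => t' i end).
split=> [l|]; first by case: split.
rewrite big_split_ord scaler_sumr; congr (_ + _); apply: eq_bigr => l _ /=.
  by rewrite -[lshift _ _]/(unsplit (inl l)) unsplitK scalerA.
by rewrite -[rshift _ _]/(unsplit (inr l)) unsplitK.
Qed.

(** * Finiteness of the spaces of sections *)

Section FiniteSections.
Context (R : realType) (n w : nat) (X : fan n w).
Local Notation N := (n + w)%N.

(** Completeness writes minus the j-th ray as a combination of rays with
    coefficients c t >= 0. Pairing with the character m such that
    e = D + div m gives e j = D j + \sum_t c t (D t - e t), and the e t are
    nonnegative. *)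
Lemma effective_coord_bounded (D : divisor n w) j : complete_fan R X ->
  exists B, forall e : 'X_{1.. N}, lin_equiv X (deg_mnm e) D -> (e j < B)%N.
Proof.
move=> complX.
have [s _ [c [c0 hc]]] := complX (- map_mx intr (row j (rays X))).
pose b : R := (D 0 j)%:~R + \sum_(t in s) c t * (D 0 t)%:~R.
exists (Num.bound b) => e [m hm].
pose P t : R := \sum_k (m 0 k)%:~R * (rays X t k)%:~R.
have eP t : (e t)%:R = (D 0 t)%:~R + P t.
  have /matrixP/(_ 0 t) := hm; rewrite !mxE => /eqP.
  rewrite subr_eq addrC => /eqP et; rewrite pmulrn et rmorphD rmorph_sum.
  by congr (_ + _); apply: eq_bigr => k _; rewrite !mxE rmorphM.
have Pj : P j = - \sum_(t in s) c t * P t.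
  rewrite -[LHS]opprK; congr (- _); rewrite -sumrN.
  under [RHS]eq_bigr do rewrite mulr_sumr.
  rewrite exchange_big; apply: eq_bigr => k _ /=.
  have /matrixP/(_ 0 k) := hc; rewrite !mxE summxE -mulrN => ->.
  by rewrite mulr_sumr; apply: eq_bigr => t _; rewrite !mxE mulrCA.
have le_eb : (e j)%:R <= b.
  rewrite eP Pj /b lerD2l -sumrN; apply: ler_sum => t _.
  rewrite -mulrN; apply: ler_wpM2l => //.
  by rewrite -subr_ge0 opprK -eP ler0n.
rewrite -(ltr_nat R); apply: (le_lt_trans le_eb).
by apply: archi_boundP; apply: le_trans le_eb; rewrite ler0n.
Qed.

Lemma effective_mdeg_bounded (D : divisor n w) : complete_fan R X ->
  exists B, forall e : 'X_{1.. N}, lin_equiv X (deg_mnm e) D -> (mdeg e < B)%N.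
Proof.
move=> complX.
have [B hB] := choice (fun j => effective_coord_bounded D j complX).
exists (\sum_j B j).+1 => e he; rewrite ltnS mdegE; apply: leq_sum => j _.
exact/ltnW/hB.
Qed.

Lemma H0_monomial_basis (D : divisor n w) : complete_fan R X ->
  exists d (v : 'I_d -> H0 R X D) (kap : 'I_d -> {scalar H0 R X D}),
    (forall f, f = \sum_m kap m f *: v m) /\
    (forall m k, kap m (v k) = (m == k)%:R).
Proof.
move=> /(effective_mdeg_bounded D)[B hB].
pose T := [set e : 'X_{1.. N < B} | `[< lin_equiv X (deg_mnm e) D >]].
pose e k : 'X_{1.. N} := bmnm (@enum_val _ (mem T) k).
have e_deg k : 'X_[e k] \in cox_degree R X D.
  apply/cox_degreeP => m; rewrite msuppX inE => /eqP ->.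
  by have := enum_valP k; rewrite inE => /asboolP.
exists #|T|, (fun k => MkH0 (e_deg k)),
  (fun k => mcoeff (e k) \o (\val : H0 R X D -> _)).
split=> [f|m k] /=; last first.
  rewrite mcoeffX eq_sym; congr (nat_of_bool _)%:R.
  by apply/eqP/eqP => [/val_inj/enum_val_inj|] ->.
apply: val_inj; apply/mpolyP => m; rewrite raddf_sum.
rewrite raddf_sum /=.
under eq_bigr do rewrite linearZ /= mcoeffX.
have [mf|mf] := boolP (m \in msupp (f : {mpoly R[i][N]})); last first.
  rewrite (memN_msupp_eq0 mf) big1 // => k _.
  case: eqP => [->|]; last by rewrite mulr0.
  by rewrite (memN_msupp_eq0 mf) mul0r.
have m_deg := elimT (cox_degreeP X D f) (H0valP f) m mf.
have mT : BMultinom (hB m m_deg) \in T by rewrite inE; apply/asboolP.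
have em : e (enum_rank_in mT (BMultinom (hB m m_deg))) = m.
  by rewrite /e enum_rankK_in.
rewrite (bigD1 (enum_rank_in mT (BMultinom (hB m m_deg)))) //= em eqxx mulr1.
rewrite big1 ?addr0 // => k /eqP hk.
case: eqP => [ek|]; last by rewrite mulr0.
by case: hk; apply/enum_val_inj/val_inj; exact: etrans ek (esym em).
Qed.

End FiniteSections.

(** * The toric statement *)

Section Multiplication.
Context (R : realType) (n w : nat) (X : fan n w) (D L : divisor n w).

(** [cox_mul] under a head constant of its own, on which linearity in the second
    factor is declared. *)
Definition section_mul (x : H0 R X D) (u : H0 R X (L - D)) : H0 R X L :=
  cox_mul x u.

Lemma val_section_mul x u : val (section_mul x u) = val x * val u.
Proof. by []. Qed.

Lemma section_mul_is_linear x : linear (section_mul x).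
Proof.
move=> c u u'; apply: val_inj.
by rewrite linearP !val_section_mul linearP mulrDr -scalerAr.
Qed.

HB.instance Definition _ x := GRing.isLinear.Build R[i]
  (H0 R X (L - D)) (H0 R X L) _ (section_mul x) (section_mul_is_linear x).

Lemma section_mul_suml r (c : 'I_r -> R[i]) (a : 'I_r -> H0 R X D) u :
  section_mul (\sum_l c l *: a l) u = \sum_l c l *: section_mul (a l) u.
Proof.
apply: val_inj; apply: etrans (val_section_mul _ _) _.
rewrite !linear_sum mulr_suml; apply: eq_bigr => l _.
by rewrite !linearZ; exact: esym (scalerAl _ _ _).
Qed.

Lemma sum_of_point_evaluations r (G : H0 R X L -> R[i]) :
  in_span_of_points r G -> sum_of_products section_mul r G.
Proof.
move=> [x [c [_ hG]]].
exists (fun l => meval (x l) \o (\val : H0 R X L -> _)), c; split=> // l.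
by exists (ev (x l)), (ev (x l)) => s u; apply: mevalM.
Qed.

(** The annihilator in degree L - D is tested against the degree L - (L - D),
    which is D only up to a propositional equality of divisors. *)
Lemma prod_space_ann (F : {scalar H0 R X L}) (f : H0 R X L) :
  prod_space (ann F (L - D)) (fun g => g \in cox_degree R X D) f ->
  lspan (kernel_products section_mul F) f.
Proof.
move=> [k [c [t [ht hf]]]].
suff /choice[s hs] : forall l, exists s : H0 R X L,
    kernel_products section_mul F s /\ val s = t l.
  exists k, c, s; split=> [l|]; first by case: (hs l).
  apply: val_inj; rewrite [LHS]hf linear_sum; apply: eq_bigr => l _.
  by rewrite linearZ; have [_ <-] := hs l.
move=> l; have [_ [g [[theta -> ker_theta] gD ->]]] := ht l.
exists (cox_mul (MkH0 gD) theta); split; last by rewrite /= mulrC.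
exists (MkH0 gD), theta; split=> // x.
have xD : (x : {mpoly R[i][n + w]}) \in cox_degree R X (L - (L - D)).
  by rewrite opprB addrC subrK H0valP.
rewrite -[RHS](ker_theta (MkH0 xD)) /contract; congr (F _).
by apply: val_inj; rewrite /= mulrC.
Qed.

Lemma prod_space_lin (P Q : {mpoly R[i][n + w]} -> Prop) c (f g : H0 R X L) :
  prod_space P Q f -> prod_space P Q g ->
  prod_space P Q (c *: f + g : H0 R X L).
Proof.
by move=> Pf Pg; rewrite -[H0val _]/(val _) linearP; exact: lspan_lin.
Qed.

End Multiplication.

Theorem theorem5p5 (R : realType) (n w : nat) (X : fan n w)
    (hX : smooth_projective_toric R X)
    (L : divisor n w) (hL : very_ample R X L)
    (F : {scalar H0 R X L}) (hF : minimal_border_rank F)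
    (i : 'I_(n + w))
    (hi : border_rank F = dim_space (H0 R X (deg_var i))) :
  (dim_quot (fun f : H0 R X L =>
     prod_space (ann F (L - deg_var i)%R)
                (fun g => g \in cox_degree R X (deg_var i))
                f) >= border_rank F)%N.
Proof.
case: hX => _ _ complX _; case: hF => conc _.
have [->|r_gt0] := posnP (border_rank F); first exact: leq0n.
have F_limit := leastP r_gt0; rewrite -/(border_rank F) in F_limit.
have [a [a_free _]] : exists a : 'I_(border_rank F) -> H0 R X (deg_var i),
    basis_mod (fun x => x = 0) a.
  by move: r_gt0; rewrite hi; exact: leastP.
set r := border_rank F in r_gt0 F_limit a a_free *.
(* Conciseness says that the functionals F (a j * _) are independent. *)
have [b det_b] : exists b : 'I_r -> H0 R X (L - deg_var i),
    \det (gram (@section_mul R n w X (deg_var i) L) a b F) != 0.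
  apply: (exists_det_neq0 (f := fun j u => F (section_mul (a j) u))) => c hc.
  apply: a_free; apply: val_inj; apply: (conc i).
  exists (\sum_l c l *: a l) => // u; rewrite -[RHS](hc u).
  rewrite -[contract _ _ _]/(F (section_mul _ u)) section_mul_suml linear_sum.
  by apply: eq_bigr => l _; rewrite linearZ.
have [N [v [kap [vK kapv]]]] := H0_monomial_basis L complX.
apply: (dim_quot_ge _ (g := v)).
- exact: prod_space_lin.
- move=> f; exists (fun m => kap m f); rewrite -vK subrr.
  by exists 0%N, (fun=> 0), (fun=> 0); split=> [[]|] //; rewrite big_ord0.
move=> d g g_span.
apply: (codim_kernel_products vK kapv det_b _ (g := g)) => [|f].
  move=> k s e p p_hom p_van; apply: F_limit p_hom _ => G hG.
  exact/p_van/sum_of_point_evaluations.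
by have [c hc] := g_span f; exists c; exact: prod_space_ann.
Qed.
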